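(* Let $(\mathfrak{g},[\cdot,\cdot],\alpha)$ be a hom-Lie algebra over $k$ and let $(V,\beta,\rho)$ be a representation of it. Then the graded vector space $C^*_{\beta,\alpha}(V,\mathfrak{g})=\bigoplus_{n\ge 1}C^n_{\beta,\alpha}(V,\mathfrak{g})$, with $C^n_{\beta,\alpha}(V,\mathfrak{g})$ placed in degree $n$, is a graded Lie algebra with the bracket $\{\!\!\{-,-\}\!\!\}$. Moreover, a linear map $T:V\to\mathfrak{g}$ satisfying $T\circ\beta=\alpha\circ T$ is an $\mathcal{O}$-operator on $(\mathfrak{g},[\cdot,\cdot],\alpha)$ with respect to $(V,\beta,\rho)$ if and only if $T\in C^1_{\beta,\alpha}(V,\mathfrak{g})$ is a Maurer-Cartan element of the graded Lie algebra $(C^*_{\beta,\alpha}(V,\mathfrak{g}),\{\!\!\{-,-\}\!\!\})$, i.e. $\{\!\!\{T,T\}\!\!\}=0$.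
   Context: The base field $k$ has characteristic zero. A (multiplicative) hom-Lie algebra $(\mathfrak{g},[\cdot,\cdot],\alpha)$ is a vector space $\mathfrak{g}$ with a skew-symmetric bilinear bracket and a linear map $\alpha:\mathfrak{g}\to\mathfrak{g}$ with $\alpha[x,y]=[\alpha(x),\alpha(y)]$ and $[\alpha(x),[y,z]]+[\alpha(y),[z,x]]+[\alpha(z),[x,y]]=0$ for all $x,y,z$. A representation $(V,\beta,\rho)$ is a vector space $V$, $\beta\in\mathrm{End}(V)$ and a linear map $\rho:\mathfrak{g}\to\mathrm{End}(V)$ with $\rho(\alpha(x))(\beta(v))=\beta(\rho(x)(v))$ and $\rho([x,y])(\beta(v))=\rho(\alpha(x))\rho(y)(v)-\rho(\alpha(y))\rho(x)(v)$. Write $\{x,v\}:=\rho(x)(v)$. An $\mathcal{O}$-operator on $(\mathfrak{g},[\cdot,\cdot],\alpha)$ with respect to $(V,\beta,\rho)$ is a linear map $T:V\to\mathfrak{g}$ with $T\circ\beta=\alpha\circ T$ and $[Tu,Tv]=T(\{Tu,v\}-\{Tv,u\})$ for all $u,v\in V$. For $n\ge1$, $C^n_{\beta,\alpha}(V,\mathfrak{g})$ is the space of linear maps $P:\wedge^nV\to\mathfrak{g}$ with $\alpha(P(v_1,\dots,v_n))=P(\beta(v_1),\dots,\beta(v_n))$. Let $S_{r_1,\dots,r_i}$ denote the set of $(r_1,\dots,r_i)$-shuffles in the symmetric group $S_{r_1+\cdots+r_i}$ and let $(-1)^{|\tau|}$ be the sign of $\tau$. For $P\in C^n_{\beta,\alpha}(V,\mathfrak{g})$,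 $Q\in C^m_{\beta,\alpha}(V,\mathfrak{g})$ the bracket $\{\!\!\{P,Q\}\!\!\}\in C^{n+m}_{\beta,\alpha}(V,\mathfrak{g})$ is $$\{\!\!\{P,Q\}\!\!\}(v_1,\dots,v_{n+m})=\sum_{\tau\in S_{m,1,n-1}}(-1)^{|\tau|}P\big(\{Q(v_{\tau(1)},\dots,v_{\tau(m)}),\beta^{m-1}(v_{\tau(m+1)})\},\beta^m(v_{\tau(m+2)}),\dots,\beta^m(v_{\tau(n+m)})\big)$$ $$+(-1)^{mn}\Big(\sum_{\tau\in S_{n,m}}(-1)^{|\tau|}\big[\alpha^{m-1}P(v_{\tau(1)},\dots,v_{\tau(n)}),\alpha^{n-1}Q(v_{\tau(n+1)},\dots,v_{\tau(n+m)})\big]$$ $$-\sum_{\tau\in S_{n,1,m-1}}(-1)^{|\tau|}Q\big(\{P(v_{\tau(1)},\dots,v_{\tau(n)}),\beta^{n-1}(v_{\tau(n+1)})\},\beta^n(v_{\tau(n+2)}),\dots,\beta^n(v_{\tau(n+m)})\big)\Big).$$ *)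

(* Defs.v *)
From HB Require Import structures.
From mathcomp Require Import all_boot all_fingroup all_algebra.
From mathcomp Require Import boolp functions.

Set Implicit Arguments.
Unset Strict Implicit.
Unset Printing Implicit Defensive.

Import GRing.Theory.
Local Open Scope ring_scope.

Record homLie (k : fieldType) (g : lmodType k) := HomLie {
  hl_bracket : {bilinear g -> g -> g};
  hl_alpha : {linear g -> g};
  hl_skew : forall x y, hl_bracket x y = - hl_bracket y x;
  hl_mult : forall x y,
    hl_alpha (hl_bracket x y) = hl_bracket (hl_alpha x) (hl_alpha y);
  hl_jacobi : forall x y z,
    hl_bracket (hl_alpha x) (hl_bracket y z) +
    hl_bracket (hl_alpha y) (hl_bracket z x) +
    hl_bracket (hl_alpha z) (hl_bracket x y) = 0
}.

(* [rep_act x v] is {x, v} = rho(x)(v); bilinearity amounts to rho being a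
   linear map from g to End(V). *)
Record homLieRep (k : fieldType) (g : lmodType k) (A : homLie g)
    (V : lmodType k) := HomLieRep {
  rep_beta : {linear V -> V};
  rep_act : {bilinear g -> V -> V};
  rep_mult : forall x v,
    rep_act (hl_alpha A x) (rep_beta v) = rep_beta (rep_act x v);
  rep_bracket : forall x y v,
    rep_act (hl_bracket A x y) (rep_beta v) =
    rep_act (hl_alpha A x) (rep_act y v) - rep_act (hl_alpha A y) (rep_act x v)
}.

Definition O_operator (k : fieldType) (g : lmodType k) (A : homLie g)
    (V : lmodType k) (M : homLieRep A V) (T : {linear V -> g}) : Prop :=
  (forall v, T (rep_beta M v) = hl_alpha A (T v)) /\
  (forall u v, hl_bracket A (T u) (T v) =
               T (rep_act M (T u) v - rep_act M (T v) u)).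

(* The space C^n_{beta,alpha}(V, g): linear maps from the n-th exterior power
   of V are encoded as alternating n-linear maps on V. *)
Section Cochains.
Variables (k : fieldType) (V g : lmodType k).
Variables (beta : {linear V -> V}) (alpha : {linear g -> g}) (n : nat).
Implicit Type P : ('I_n -> V) -> g.

Definition multilinear P : Prop :=
  forall (v : 'I_n -> V) (i : 'I_n) (a : k) (x y : V),
    P [eta v with i |-> a *: x + y] =
    a *: P [eta v with i |-> x] + P [eta v with i |-> y].

Definition alternating P : Prop :=
  forall (v : 'I_n -> V) (i j : 'I_n), i != j -> v i = v j -> P v = 0.

Definition is_cochain P : Prop :=
  [/\ multilinear P, alternating P &
      forall v, alpha (P v) = P (fun i => beta (v i))].

Definition cochain_pred : {pred ('I_n -> V) -> g} := fun P => `[< is_cochain P >].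

Lemma cochain_submod_closed : submod_closed cochain_pred.
Proof.
split=> [|a P Q /asboolP[mP aP cP] /asboolP[mQ aQ cQ]]; apply/asboolP.
  split=> [v i a x y|v i j _ _|v] //=; last by rewrite linear0.
  by rewrite scaler0 addr0.
split=> [v i b x y|v i j ij vij|v].
- rewrite !addrfctE !scalrfctE mP mQ !scalerDr !scalerA [b * a]mulrC.
  by rewrite addrACA.
- by rewrite addrfctE scalrfctE (aP v i j) ?(aQ v i j) // scaler0 addr0.
- by rewrite !addrfctE !scalrfctE linearP cP cQ.
Qed.

HB.instance Definition _ :=
  GRing.isSubmodClosed.Build k (('I_n -> V) -> g) cochain_pred
    cochain_submod_closed.

Record cochain := Cochain {
  cochain_fun :> ('I_n -> V) -> g;
  cochainP : cochain_fun \in cochain_pred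
}.

HB.instance Definition _ := [isSub for cochain_fun].
HB.instance Definition _ := [Choice of cochain by <:].
HB.instance Definition _ := [SubChoice_isSubLmodule of cochain by <:].

End Cochains.

(* A linear map T with T o beta = alpha o T, as an element of C^1. *)
Section DegreeOne.
Variables (k : fieldType) (V g : lmodType k).
Variables (beta : {linear V -> V}) (alpha : {linear g -> g}).
Variables (T : {linear V -> g}) (hT : forall v, T (beta v) = alpha (T v)).

Lemma cochain1_subproof :
  (fun v : 'I_1 -> V => T (v ord0)) \in cochain_pred beta alpha (n := 1%N).
Proof.
apply/asboolP; split=> [v i a x y|v i j|v] /=.
- by rewrite (ord1 i) /= linearP.
- by rewrite (ord1 i) (ord1 j).
- by rewrite hT.
Qed.

Definition cochain1 : cochain beta alpha 1%N := Cochain cochain1_subproof.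

End DegreeOne.

(* (r_1, ..., r_i)-shuffles: permutations increasing on each of the
   consecutive blocks of sizes r_1, ..., r_i.  [reshape_index r i] is the
   number of the block containing position i.  Only used when
   sumn r = N; positions and values are numbered from 0. *)
Definition shuffle (N : nat) (r : seq nat) (tau : 'S_N) : bool :=
  [forall i : 'I_N, forall j : 'I_N,
     (i < j)%N && (reshape_index r i == reshape_index r j) ==> (tau i < tau j)%N].

Section Bracket.
Variables (k : fieldType) (g : lmodType k) (A : homLie g).
Variables (V : lmodType k) (M : homLieRep A V).
Local Notation alpha := (hl_alpha A).
Local Notation beta := (rep_beta M).

(* For P of arity n and Q of arity m, the sum over S_{m,1,n-1} of the terms
   (-1)^|tau| P({Q(v_tau(1), ..., v_tau(m)), beta^{m-1} v_tau(m+1)},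
                beta^m v_tau(m+2), ..., beta^m v_tau(m+n)).
   With 0-based indices, the i-th argument of P involves v_tau(m+i), i.e.
   v (tau (rshift m i)), and i = 0 is the argument containing Q. *)
Definition insertion_sum (n m : nat) (P : ('I_n -> V) -> g)
    (Q : ('I_m -> V) -> g) (v : 'I_(m + n) -> V) : g :=
  \sum_(tau : 'S_(m + n) | shuffle [:: m; 1%N; n.-1] tau)
    (-1) ^+ tau *:
      P (fun i : 'I_n =>
           if i == 0%N :> nat then
             rep_act M (Q (fun j => v (tau (lshift n j))))
                       (iter m.-1 beta (v (tau (rshift m i))))
           else iter m beta (v (tau (rshift m i)))).

Definition cochain_bracket (n m : nat) (P : ('I_n -> V) -> g)
    (Q : ('I_m -> V) -> g) (v : 'I_(n + m) -> V) : g :=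
  insertion_sum P Q (fun i => v (cast_ord (addnC m n) i)) +
  (-1) ^+ (m * n) *:
    (\sum_(tau : 'S_(n + m) | shuffle [:: n; m] tau)
       (-1) ^+ tau *:
         hl_bracket A
           (iter m.-1 alpha (P (fun i => v (tau (lshift m i)))))
           (iter n.-1 alpha (Q (fun j => v (tau (rshift n j)))))
     - insertion_sum Q P v).

End Bracket.

(* Graded Lie algebras concentrated in degrees >= 1: [L n] is the homogeneous
   component of degree n for n >= 1, and [L 0] is irrelevant. *)
Section GradedLie.
Variables (k : fieldType) (L : nat -> lmodType k).
Variable br : forall m n : nat, L m -> L n -> L (m + n).

Definition degree_cast (m n : nat) (e : m = n) (x : L m) : L n :=
  ecast i (L i) e x.

Record graded_lie : Prop := GradedLie {
  graded_lie_linearr : forall m n (x : L m), (0 < m)%N -> (0 < n)%N ->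
    linear (fun y : L n => br x y);
  graded_lie_linearl : forall m n (y : L n), (0 < m)%N -> (0 < n)%N ->
    linear (fun x : L m => br x y);
  graded_lie_skew : forall m n (x : L m) (y : L n), (0 < m)%N -> (0 < n)%N ->
    br x y = - ((-1) ^+ (m * n) *: degree_cast (addnC n m) (br y x));
  graded_lie_jacobi : forall m n p (x : L m) (y : L n) (z : L p),
    (0 < m)%N -> (0 < n)%N -> (0 < p)%N ->
    br x (br y z) =
      degree_cast (esym (addnA m n p)) (br (br x y) z) +
      (-1) ^+ (m * n) *: degree_cast (addnCA n m p) (br y (br x z))
}.

(* Maurer-Cartan elements, for the zero differential. *)
Definition maurer_cartan (x : L 1) : Prop := br x x = 0.

End GradedLie.

(* Main.v *)
(**
  A cochain [P] of degree [n] defines a vector field [X_P] of degree [n] on the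
  odd space [V], the twisted wedge product of [P] with the identity of [V] along
  the action, and hence a Lie derivative [L_P].  The bracket reads
    [{{P, Q}} = L_Q P + (-1)^(mn) ([P, Q] - L_P Q)],
  where [[P, Q]] is the wedge product along the bracket of [g].  Three facts
  give the graded Jacobi identity: [L_P] is a derivation of wedge products up to
  the twist; the commutator of two Lie derivatives is a Lie derivative; and
    [X_{{P, Q}} = L_Q X_P - (-1)^(mn) L_P X_Q],
  where the first axiom of a representation makes [X] equivariant and the second
  one computes [X_[P, Q]].  After expansion only the Jacobi identity of the
  twisted wedge bracket is left.

  To avoid permutations in these computations, alternating maps are functions of
  lists, and sums over shuffles are replaced with a signed sum over the
  unshuffles of a list, defined by recursion on the list: the head goes to the
  left part, or to the right part with a sign for jumping over the left part.
  Coassociativity and graded cocommutativity then follow by induction.  The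
  permutations reappear only when unshuffles are identified with shuffles: the
  first vector is sent to the first position of one of the blocks, and removing
  it from the permutation is the inverse of [lift_perm].
*)
Require Import Defs.
From mathcomp Require Import all_boot all_fingroup all_algebra.
From mathcomp Require Import boolp functions.
From mathcomp Require Import zify ring.

Set Implicit Arguments.
Unset Strict Implicit.
Unset Printing Implicit Defensive.

Import GRing.Theory.
Local Open Scope ring_scope.

(** * Reflexive proofs of identities between linear combinations in a module *)

Section LinearCombinations.
Variables (R : nzRingType) (W : lmodType R).

Inductive lincomb :=
  LAtom of nat | LZero | LAdd of lincomb & lincomb | LOpp of lincomb
| LScale of R & lincomb.

Fixpoint lc_eval (e : seq W) t : W :=
  match t with
  | LAtom i => e`_i
  | LZero => 0
  | LAdd t1 t2 => lc_eval e t1 + lc_eval e t2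
  | LOpp t1 => - lc_eval e t1
  | LScale a t1 => a *: lc_eval e t1
  end.

Fixpoint lc_coef t i : R :=
  match t with
  | LAtom j => if i == j then 1 else 0
  | LZero => 0
  | LAdd t1 t2 => lc_coef t1 i + lc_coef t2 i
  | LOpp t1 => - lc_coef t1 i
  | LScale a t1 => a * lc_coef t1 i
  end.

(** Being a computed conjunction, it reduces to one scalar identity per atom, each a goal for
    [ring]. *)
Fixpoint lc_same n t1 t2 : Prop :=
  if n is n'.+1 then lc_coef t1 n' = lc_coef t2 n' /\ lc_same n' t1 t2
  else True.

Lemma lc_evalE e t : lc_eval e t = \sum_(i < size e) lc_coef t i *: e`_i.
Proof.
elim: t => /= [j||t1 -> t2 ->|t ->|a t ->].
- have [lt_j|le_j] := ltnP j (size e).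
    rewrite (bigD1 (Ordinal lt_j)) //= eqxx scale1r big1 ?addr0 // => i.
    by rewrite -val_eqE => /negPf /= ->; rewrite scale0r.
  rewrite nth_default // big1 // => i _; rewrite ltn_eqF ?scale0r //.
  exact: leq_trans le_j.
- by rewrite big1 // => i _; rewrite scale0r.
- by rewrite -big_split; apply: eq_bigr => i _; rewrite scalerDl.
- by rewrite -sumrN; apply: eq_bigr => i _; rewrite scaleNr.
- by rewrite scaler_sumr; apply: eq_bigr => i _; rewrite scalerA.
Qed.

Lemma lc_eq e t1 t2 : lc_same (size e) t1 t2 -> lc_eval e t1 = lc_eval e t2.
Proof.
rewrite !lc_evalE.
elim: (size e) (fun i => e`_i) => [|n IHn] f /= eq12.
  by rewrite !big_ord0.
by rewrite !big_ord_recr /= IHn ?(proj1 eq12) //; case: eq12 => _.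
Qed.

End LinearCombinations.

Ltac lc_index x e :=
  lazymatch e with
  | x :: _ => constr:(O)
  | _ :: ?e' => let i := lc_index x e' in constr:(S i)
  end.

Ltac lc_atoms t e :=
  lazymatch t with
  | 0 => e
  | ?a + ?b => let e1 := lc_atoms a e in lc_atoms b e1
  | - ?a => lc_atoms a e
  | _ *: ?a => lc_atoms a e
  | _ => let i := match e with _ => lc_index t e | _ => constr:(tt) end in
    lazymatch i with tt => constr:(t :: e) | _ => e end
  end.

Ltac lc_reify R t e :=
  lazymatch t with
  | 0 => constr:(LZero R)
  | ?a + ?b => let a1 := lc_reify R a e in let b1 := lc_reify R b e in
    constr:(LAdd a1 b1)
  | - ?a => let a1 := lc_reify R a e in constr:(LOpp a1)
  | ?c *: ?a => let a1 := lc_reify R a e in constr:(@LScale R c a1)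
  | _ => let i := lc_index t e in constr:(@LAtom R i)
  end.

(* Compares the coefficients of each atom of a module identity with [ring]. *)
Ltac lin R :=
  lazymatch goal with |- @eq ?W ?x ?y =>
    let e := lc_atoms x (@nil W) in
    let e := lc_atoms y e in
    let x1 := lc_reify R x e in let y1 := lc_reify R y e in
    refine (@lc_eq R _ e x1 y1 _);
    cbn -[GRing.exp expn addn muln GRing.add GRing.mul
            GRing.opp GRing.zero GRing.one];
    repeat (split; [ring|]); exact I
  end.

Lemma signr_if (R : pzRingType) n : (-1) ^+ n = (if odd n then -1 else 1) :> R.
Proof. by rewrite -signr_odd; case: odd. Qed.

(** Evaluates powers of -1 by cases on the parities of the exponents, which leaves coefficients that
    [ring] can compare. *)
Ltac parity :=
  rewrite ?signr_if ?(oddD, oddM, oddS, size_map) /=;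
  repeat match goal with |- context [odd ?n] => case: (odd n) => /= end.

(** * Signed unshuffles of lists *)

Section Unshuffle.
Variables (k : fieldType) (T : Type) (W : lmodType k).
Implicit Types (F G : seq T -> seq T -> W) (s A B C : seq T).

(** All sizes of the two parts are summed over; a fixed type of unshuffle is selected by summands
    that vanish on lists of the wrong length. *)
Fixpoint unsh F s : W :=
  if s is x :: s' then
    unsh (fun A B => F (x :: A) B + (-1) ^+ size A *: F A (x :: B)) s'
  else F [::] [::].

Lemma eq_unsh F G s :
    (forall A B, (size A + size B)%N = size s -> F A B = G A B) ->
  unsh F s = unsh G s.
Proof.
elim: s F G => [|x s IHs] F G eqFG /=; first exact: eqFG.
by apply: IHs => A B sAB; rewrite !eqFG //= ?addnS ?addSn sAB.
Qed.

Lemma unsh_linear F G s a :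
  unsh (fun A B => a *: F A B + G A B) s = a *: unsh F s + unsh G s.
Proof.
elim: s F G => [//|x s IHs] F G /=.
rewrite -IHs; apply: eq_unsh => A B _.
by rewrite !scalerDr !scalerA [_ * a]mulrC addrACA.
Qed.

Lemma unshD F G s : unsh (fun A B => F A B + G A B) s = unsh F s + unsh G s.
Proof.
rewrite -[unsh F s]scale1r -unsh_linear.
by apply: eq_unsh => A B _; rewrite scale1r.
Qed.

Lemma unsh0 s : unsh (fun _ _ => 0) s = 0.
Proof.
elim: s => [//|x s IHs] /=; rewrite -[RHS]IHs.
by apply: eq_unsh => A B _; rewrite scaler0 addr0.
Qed.

Lemma unshZ F s a : unsh (fun A B => a *: F A B) s = a *: unsh F s.
Proof.
rewrite -[RHS]addr0 -(unsh0 s) -unsh_linear.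
by apply: eq_unsh => A B _; rewrite addr0.
Qed.

(** Both sides run over splittings into three parts, and the head joins each part with the same sign
    whichever cut is made first. *)
Lemma unsh_assoc (F : seq T -> seq T -> seq T -> W) s :
  unsh (fun A C => unsh (fun A B => F A B C) A) s =
  unsh (fun A B => unsh (fun B C => F A B C) B) s.
Proof.
elim: s F => [//|x s IHs] F /=.
transitivity (unsh (fun A C => unsh (fun A B => F (x :: A) B C
   + (-1) ^+ size A *: F A (x :: B) C
   + (-1) ^+ (size A + size B) *: F A B (x :: C)) A) s).
  apply: eq_unsh => A C _ /=.
  rewrite [RHS]unshD; congr (_ + _); rewrite -unshZ; apply: eq_unsh => A' B ->.
  by [].
rewrite (IHs (fun A B C => F (x :: A) B C
   + (-1) ^+ size A *: F A (x :: B) C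
   + (-1) ^+ (size A + size B) *: F A B (x :: C))).
apply: eq_unsh => A B _; rewrite -unshZ -unshD; apply: eq_unsh => C D _.
by rewrite scalerDr scalerA -exprD addrA.
Qed.

(** Exchanging the two parts moves every element of one past every element of the other. *)
Lemma unsh_swap F s :
  unsh F s = unsh (fun A B => (-1) ^+ (size A * size B) *: F B A) s.
Proof.
elim: s F => [|x s IHs] F /=; first by rewrite scale1r.
rewrite IHs; apply: eq_unsh => A B _ /=.
rewrite scalerDr !scalerA addrC mulSn mulnS !exprD !mulrA -expr2 sqrr_sign.
by rewrite mul1r [_ * (-1) ^+ size B]mulrC.
Qed.

(** Coassociativity groups the first two of three parts, so that [unsh_swap] can exchange them. *)
Lemma unsh_left_comm (F : seq T -> seq T -> seq T -> W) s :
  unsh (fun A B => unsh (fun B C => F A B C) B) s =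
  unsh (fun A B => unsh (fun B C => (-1) ^+ (size A * size B) *: F B A C) B) s.
Proof.
rewrite -!unsh_assoc; apply: eq_unsh => A C _.
by rewrite unsh_swap.
Qed.

End Unshuffle.

Lemma unsh_map (k : fieldType) (T T' : Type) (W : lmodType k) (h : T -> T')
    (F : seq T' -> seq T' -> W) s :
  unsh F (map h s) = unsh (fun A B => F (map h A) (map h B)) s.
Proof.
elim: s F => [//|x s IHs] F /=; rewrite IHs.
by apply: eq_unsh => A B _ /=; rewrite size_map.
Qed.

Lemma unsh_comp (k : fieldType) (T : Type) (W W' : lmodType k) (f : W -> W')
    (F : seq T -> seq T -> W) s : linear f ->
  f (unsh F s) = unsh (fun A B => f (F A B)) s.
Proof.
move=> linf; elim: s F => [//|x s IHs] F /=; rewrite IHs.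
apply: eq_unsh => A B _.
by rewrite addrC linf addrC.
Qed.

(** * Multilinear and antisymmetric functions of lists *)

Section Alternating.
Variables (k : fieldType) (V W : lmodType k).
Implicit Types (s : seq V) (F : seq V -> W) (G : seq V -> seq V -> W).

Definition mlin F := forall s1 a x y s2,
  F (s1 ++ (a *: x + y) :: s2) = a *: F (s1 ++ x :: s2) + F (s1 ++ y :: s2).

Definition asym F := forall s1 x y s2,
  F (s1 ++ x :: y :: s2) = - F (s1 ++ y :: x :: s2).

(* Functions of all lists encode [n]-ary maps by vanishing off length [n]. *)
Definition supp n F := forall s, size s != n -> F s = 0.

Lemma unsh_mlin G : (forall B, mlin (G^~ B)) -> (forall A, mlin (G A)) ->
  mlin (unsh G).
Proof.
move=> mG1 mG2 s1 a x y s2; elim: s1 G mG1 mG2 => [|z s1 IHs] G mG1 mG2 /=.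
  rewrite -unsh_linear; apply: eq_unsh => A B _.
  rewrite (mG1 _ [::]) (mG2 _ [::]) !scalerDr !scalerA [a * _]mulrC.
  by rewrite addrACA.
rewrite IHs // => [B t1 b u v t2|A t1 b u v t2].
  rewrite (mG1 _ (z :: t1)) mG1 !size_cat /= !scalerDr !scalerA [b * _]mulrC.
  by rewrite addrACA.
rewrite mG2 (mG2 _ (z :: t1)) !scalerDr !scalerA [b * _]mulrC.
by rewrite addrACA.
Qed.

(** If the two neighbours fall into the same part, the antisymmetry of [G] applies; if they are
    separated, their exchange pairs terms of opposite signs. *)
Lemma unsh_asym G : (forall B, asym (G^~ B)) -> (forall A, asym (G A)) ->
  asym (unsh G).
Proof.
move=> aG1 aG2 s1 x y s2; elim: s1 G aG1 aG2 => [|z s1 IHs] G aG1 aG2 /=.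
  rewrite -scaleN1r -unshZ; apply: eq_unsh => A B _.
  rewrite (aG1 _ [::]) (aG2 _ [::]) /=; parity; lin k.
rewrite IHs // => [B t1 u v t2|A t1 u v t2].
  by rewrite (aG1 B (z :: t1)) (aG1 (z :: B) t1) !size_cat scalerN opprD.
by rewrite (aG2 (z :: A) t1) (aG2 A (z :: t1)) scalerN opprD.
Qed.

(** Adjacent transpositions bring the two copies of [x] together; the value is then its own
    opposite, and 2 is invertible. *)
Lemma asym_repeat F s1 s2 s3 x : 2%:R != 0 :> k -> asym F ->
  F (s1 ++ x :: s2 ++ x :: s3) = 0.
Proof.
move=> k2 aF; elim: s2 s1 => [|y s2 IHs] s1 /=.
  have /eqP := aF s1 x x s3.
  rewrite -addr_eq0 -mulr2n -scaler_nat scaler_eq0 (negPf k2) => /eqP ->//.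
by rewrite aF -cat_rcons IHs oppr0.
Qed.

Lemma mlin_head F s : mlin F -> linear (fun x => F (x :: s)).
Proof. by move=> mF a x y; apply: (mF [::]). Qed.

Lemma mlin_head0 F s : mlin F -> F (0 :: s) = 0.
Proof.
move=> mF; have := mlin_head s mF 1 0 0; rewrite !scale1r addr0.
by move/eqP; rewrite -subr_eq subrr => /eqP.
Qed.

Lemma unsh_supp m n G s : (forall B, supp m (G^~ B)) ->
  (forall A, supp n (G A)) -> (size s != m + n)%N -> unsh G s = 0.
Proof.
move=> sG1 sG2 ns; rewrite -(unsh0 W s); apply: eq_unsh => A B sAB.
have [eA|/sG1-> //] := eqVneq (size A) m.
have [eB|/sG2-> //] := eqVneq (size B) n.
by rewrite -sAB eA eB eqxx in ns.
Qed.

Lemma mlin_linear (F H : seq V -> W) (a : k) :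
  mlin F -> mlin H -> mlin (a *: F + H).
Proof.
move=> mF mG s1 b x y s2; rewrite addrfctE scalrfctE mF mG !scalerDr !scalerA.
by rewrite [a * b]mulrC addrACA.
Qed.

Lemma asym_linear (F H : seq V -> W) (a : k) :
  asym F -> asym H -> asym (a *: F + H).
Proof.
move=> aF aG s1 x y s2.
by rewrite addrfctE scalrfctE aF aG scalerN opprD.
Qed.

Lemma supp_linear n (F H : seq V -> W) (a : k) :
  supp n F -> supp n H -> supp n (a *: F + H).
Proof.
by move=> sF sG s ns; rewrite addrfctE scalrfctE sF ?sG // scaler0 addr0.
Qed.

End Alternating.

(** * Pullbacks, Lie derivatives and wedge products *)

Section Operators.
Variables (k : fieldType) (V : lmodType k) (beta : {linear V -> V}).
Local Notation pow j := (map (iter j beta)).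

Lemma iter_linear j : linear (iter j beta).
Proof. by move=> a x y; elim: j => //= j ->; rewrite linearP. Qed.

Lemma map_iterD i j s : pow i (pow j s) = pow (i + j)%N s.
Proof. by rewrite -map_comp; apply: eq_map => x; rewrite /= iterD. Qed.

Definition pull (W : lmodType k) j (F : seq V -> W) : seq V -> W :=
  fun s => F (pow j s).

(* [X] has one more argument than its degree [j]: the twist [beta^j] is applied
   to the arguments that do not enter [X]. *)
Definition lieD (W : lmodType k) j (X : seq V -> V) (F : seq V -> W) :
    seq V -> W :=
  fun s => unsh (fun A B => F (X A :: pow j B)) s.

(** No twist is built in; twists are supplied by applying [pull] to the factors. *)
Definition wedge (U1 U2 W : lmodType k) (b : U1 -> U2 -> W)
    (F : seq V -> U1) (G : seq V -> U2) : seq V -> W :=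
  fun s => unsh (fun A B => b (F A) (G B)) s.

Lemma pullD (W : lmodType k) i j (F : seq V -> W) :
  pull i (pull j F) = pull (i + j)%N F.
Proof. by apply/funext => s; rewrite /pull map_iterD addnC. Qed.

Lemma pull_wedge (U1 U2 W : lmodType k) (b : U1 -> U2 -> W) j F G :
  pull j (wedge b F G) = wedge b (pull j F) (pull j G).
Proof. by apply/funext => s; rewrite /pull /wedge unsh_map. Qed.

Definition equi (W : lmodType k) (phi : W -> W) (F : seq V -> W) :=
  forall s, F (pow 1 s) = phi (F s).

Lemma equi_iter (W : lmodType k) (phi : W -> W) F j s : equi phi F ->
  F (pow j s) = iter j phi (F s).
Proof.
move=> eF; elim: j => [|j IHj] /=; first by rewrite map_id.
by rewrite -IHj -eF map_iterD.
Qed.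

Lemma pull_lieD (W : lmodType k) i j X (F : seq V -> W) : equi beta X ->
  pull i (lieD j X F) = lieD j X (pull i F).
Proof.
move=> eX; apply/funext => s; rewrite /pull /lieD unsh_map.
apply: eq_unsh => A B _ /=.
by rewrite (equi_iter _ _ eX) !map_iterD addnC.
Qed.

(** Twisted Leibniz rule: the value of [X] heads the list that the wedge distributes, so it enters
    either [F] or [G], and the factor it misses is pulled back by the twist. *)
Lemma lieD_wedge (U1 U2 W : lmodType k) (b : {bilinear U1 -> U2 -> W})
    x f X (F : seq V -> U1) (G : seq V -> U2) :
  supp x.+1 X -> supp f F -> (forall s, F (0 :: s) = 0) ->
  (forall s, G (0 :: s) = 0) ->
  lieD x X (wedge b F G) =
    wedge b (lieD x X F) (pull x G) +
    (-1) ^+ (x * f) *: wedge b (pull x F) (lieD x X G).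
Proof.
move=> sX sF F0 G0; apply/funext => s.
rewrite addrfctE scalrfctE /lieD /wedge /=.
transitivity (unsh (fun A B => unsh (fun C D =>
    b (F (X A :: pow x C)) (G (pow x D))
    + (-1) ^+ size C *: b (F (pow x C)) (G (X A :: pow x D))) B) s).
  apply: eq_unsh => A B _; rewrite unsh_map.
  by apply: eq_unsh => C D _; rewrite size_map.
transitivity (unsh (fun A B => unsh (fun C D =>
      b (F (X A :: pow x C)) (G (pow x D))) B) s
  + unsh (fun A B => unsh (fun C D =>
      (-1) ^+ size C *: b (F (pow x C)) (G (X A :: pow x D))) B) s).
  by rewrite -unshD; apply: eq_unsh => A B _; rewrite -unshD.
congr (_ + _).
  rewrite -unsh_assoc; apply: eq_unsh => A B _.
  rewrite /pull (@unsh_comp _ _ _ _ (fun z => b z (G (pow x B)))) //.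
  by move=> a u v; rewrite linearPl.
(* The [x.+1] arguments of [X] and then the value of [X] jump over the [f] arguments of [F], whence
   the sign (-1)^(xf). *)
rewrite unsh_left_comm -unshZ; apply: eq_unsh => A B _.
rewrite /pull (@unsh_comp _ _ _ _ (fun z => b (F (pow x A)) z)); last first.
  by move=> a u v; rewrite linearPr.
rewrite -unshZ; apply: eq_unsh => C D _; rewrite scalerA.
have [eA|nA] := eqVneq (size A) f; last first.
  by rewrite sF ?size_map // linear0l !scaler0.
have [eC|nC] := eqVneq (size C) x.+1; last first.
  by rewrite sX // G0 linear0r !scaler0.
by rewrite eA eC; parity; lin k.
Qed.

(* The terms where [X] and [Y] enter different arguments of [F] are graded
   symmetric in [X] and [Y], so only the nested ones survive. *)
Lemma lieD_comm (W : lmodType k) x y X Y (F : seq V -> W) :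
  supp x.+1 X -> supp y.+1 Y -> equi beta X -> equi beta Y ->
  mlin F -> asym F ->
  lieD x X (lieD y Y F) - (-1) ^+ (x * y) *: lieD y Y (lieD x X F) =
  lieD (x + y)%N (lieD x X Y) F
    - (-1) ^+ (x * y) *: lieD (x + y)%N (lieD y Y X) F.
Proof.
move=> sX sY eX eY mF aF.
(* The value of [X] is here an argument of [F] beside the value of [Y]; the sign is for jumping over
   the arguments of [Y]. *)
pose S x y X Y s := unsh (fun A B => unsh (fun C D =>
  (-1) ^+ size C *:
    F (Y (pow x C) :: iter y beta (X A) :: pow (x + y)%N D)) B) s : W.
have lieD2 x' y' X' Y' : lieD x' X' (lieD y' Y' F) =
    lieD (x' + y')%N (lieD x' X' Y') F + S x' y' X' Y'.
  apply/funext => s; rewrite addrfctE /lieD.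
  transitivity (unsh (fun A B => unsh (fun C D =>
      F (Y' (X' A :: pow x' C) :: pow (x' + y')%N D)) B) s + S x' y' X' Y' s).
    rewrite -unshD; apply: eq_unsh => A B _ /=.
    rewrite unsh_map -unshD; apply: eq_unsh => C D _ /=.
    by rewrite !map_iterD addnC size_map.
  congr (_ + _); rewrite -unsh_assoc; apply: eq_unsh => A B _.
  by rewrite (unsh_comp _ _ (mlin_head _ mF)).
have symS : S x y X Y = (-1) ^+ (x * y) *: S y x Y X.
  apply/funext => s; rewrite scalrfctE {1}/S unsh_left_comm -unshZ.
  apply: eq_unsh => A B _; rewrite -unshZ; apply: eq_unsh => C D _.
  (* By equivariance the twists on the values of [X] and [Y] move to their arguments; both sides
     then have the same two leading arguments of [F], in opposite orders. *)
  rewrite (aF [::]) -!(equi_iter _ _ eX) -!(equi_iter _ _ eY) [(y + x)%N]addnC.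
  have [eA|nA] := eqVneq (size A) y.+1; last first.
    rewrite sY ?size_map // (aF [::]) (mlin_head0 _ mF).
    by rewrite !(scaler0, oppr0).
  have [eC|nC] := eqVneq (size C) x.+1; last first.
    by rewrite sX ?size_map // (mlin_head0 _ mF) !(scaler0, oppr0).
  by rewrite eA eC; parity; lin k.
rewrite (lieD2 x y X Y) (lieD2 y x Y X) symS [(y + x)%N]addnC.
by parity; lin k.
Qed.

End Operators.

Lemma lincomb_fctE (k : pzRingType) (T : Type) (W : lmodType k) (a : k)
    (F G : T -> W) x :
  (a *: F + G) x = a *: F x + G x.
Proof. by []. Qed.

(** * Cochains as functions of lists, and their closure properties *)

Section ListCochains.
Variables (k : fieldType) (V : lmodType k) (beta : {linear V -> V}).
Local Notation pow j := (map (iter j beta)).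

(** The target and its twist [phi] are parameters, to cover cochains with values in [g] as well as
    vector fields with values in [V]. *)
Record lcoch (W : lmodType k) (phi : W -> W) n (F : seq V -> W) : Prop := {
  lcoch_supp : supp n F;
  lcoch_mlin : mlin F;
  lcoch_asym : asym F;
  lcoch_equi : equi beta phi F
}.

Lemma mlin_pull (W : lmodType k) j (F : seq V -> W) :
  mlin F -> mlin (pull beta j F).
Proof.
by move=> mF s1 a x y s2; rewrite /pull !map_cat /= iter_linear mF.
Qed.

Lemma asym_pull (W : lmodType k) j (F : seq V -> W) :
  asym F -> asym (pull beta j F).
Proof. by move=> aF s1 x y s2; rewrite /pull !map_cat /= aF. Qed.

Lemma lcoch_linear (W : lmodType k) (phi : {linear W -> W}) n (F G : seq V -> W)
  (a : k) : lcoch phi n F -> lcoch phi n G -> lcoch phi n (a *: F + G).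
Proof.
case=> [sF mF aF eF] [sG mG aG eG].
split; [exact: supp_linear|exact: mlin_linear|exact: asym_linear|move=> s].
by rewrite addrfctE scalrfctE eF eG linearP.
Qed.

Lemma lcoch_pull (W : lmodType k) (phi : W -> W) n j (F : seq V -> W) :
  lcoch phi n F -> lcoch phi n (pull beta j F).
Proof.
case=> sF mF aF eF; split; [|exact: mlin_pull|exact: asym_pull|] => s.
  by move=> ns; rewrite /pull sF ?size_map.
by rewrite /pull map_iterD addnC -map_iterD eF.
Qed.

Lemma lcoch_wedge (U1 U2 W : lmodType k) (b : {bilinear U1 -> U2 -> W})
    (phi1 : U1 -> U1) (phi2 : U2 -> U2) (phi : {linear W -> W}) n m F G :
  (forall u v, phi (b u v) = b (phi1 u) (phi2 v)) ->
  lcoch phi1 n F -> lcoch phi2 m G -> lcoch phi (n + m)%N (wedge b F G).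
Proof.
move=> phib [sF mF aF eF] [sG mG aG eG]; split=> [s|||s].
- apply: unsh_supp => [B A sA|A B sB]; first by rewrite sF // linear0l.
  by rewrite sG // linear0r.
- apply: unsh_mlin => [B|A] s1 a x y s2; first by rewrite mF linearPl.
  by rewrite mG linearPr.
- apply: unsh_asym => [B|A] s1 x y s2; first by rewrite aF linearNl.
  by rewrite aG linearNr.
rewrite /wedge unsh_map (unsh_comp (f := phi)); last first.
  by move=> a x y; rewrite linearP.
by apply: eq_unsh => A B _; rewrite eF eG phib.
Qed.

Lemma lcoch_lieD (W : lmodType k) (phi : {linear W -> W}) x f X F :
  (0 < f)%N -> lcoch beta x.+1 X -> lcoch phi f F ->
  lcoch phi (x + f)%N (lieD beta x X F).
Proof.
case: f => // f _ [sX mX aX eX] [sF mF aF eF]; split=> [s|||s].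
(* [X] consumes [x.+1] entries, and [F] one entry less than its arity, since its head is the value
   of [X]. *)
- rewrite addnS -addSn.
  apply: unsh_supp => [B A sA|A B sB]; first by rewrite sX // mlin_head0.
  by rewrite sF //= size_map.
- apply: unsh_mlin => [B|A] s1 a y z s2.
    by rewrite mX (mlin_head _ mF).
  by rewrite !map_cat /= iter_linear (mF (_ :: _)).
- apply: unsh_asym => [B|A] s1 y z s2.
    rewrite aX -scaleN1r -[_ *: _]addr0 (mlin_head _ mF) mlin_head0 // addr0.
    by rewrite scaleN1r.
  by rewrite !map_cat (aF (_ :: _)).
rewrite /lieD unsh_map (unsh_comp (f := phi)); last first.
  by move=> a y z; rewrite linearP.
apply: eq_unsh => A B _; rewrite eX -eF /= !map_iterD; congr (F (_ :: _)).
by rewrite addnC.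
Qed.

Definition idform (s : seq V) : V := if s is [:: x] then x else 0.

Lemma lcoch_idform : lcoch beta 1 idform.
Proof.
split=> [[|? []]|[|? []] // a x y s2|[|? [|? ?]] x y s2|[|? []]] //=;
  rewrite ?(scaler0, addr0, oppr0, linear0) //.
by case: s2 => *; rewrite /= ?scaler0 ?addr0.
Qed.

Lemma unsh_nilr (W : lmodType k) (F : seq V -> W) s :
  unsh (fun A B => if B is [::] then F A else 0) s = F s.
Proof.
elim: s F => [//|x s IHs] F /=; rewrite -[RHS](IHs (fun A => F (x :: A))).
by apply: eq_unsh => A B _; rewrite scaler0 addr0.
Qed.

(** Only the splitting with an empty right part survives in [idform]; a vector field is thus
    recovered from its Lie derivative. *)
Lemma lieD_idform x X : lieD beta x X idform = X.
Proof.
apply/funext => s; rewrite -[RHS]unsh_nilr.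
by apply: eq_unsh => A [].
Qed.

Section Linearity.
Variables (U1 U2 W : lmodType k) (b : {bilinear U1 -> U2 -> W}).

Lemma wedge_linearl (a : k) (F F' : seq V -> U1) G :
  wedge b (a *: F + F') G = a *: wedge b F G + wedge b F' G.
Proof.
apply/funext => s; rewrite lincomb_fctE /wedge -unsh_linear.
by apply: eq_unsh => A B _; rewrite lincomb_fctE linearPl.
Qed.

Lemma wedge_linearr (a : k) F (G G' : seq V -> U2) :
  wedge b F (a *: G + G') = a *: wedge b F G + wedge b F G'.
Proof.
apply/funext => s; rewrite lincomb_fctE /wedge -unsh_linear.
by apply: eq_unsh => A B _; rewrite lincomb_fctE linearPr.
Qed.

Lemma lieD_linearr x X (a : k) (F G : seq V -> W) :
  lieD beta x X (a *: F + G) = a *: lieD beta x X F + lieD beta x X G.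
Proof.
by apply/funext => s; rewrite lincomb_fctE /lieD -unsh_linear.
Qed.

Lemma lieD_linearl x X Y (a : k) (F : seq V -> W) : mlin F ->
  lieD beta x (a *: X + Y) F = a *: lieD beta x X F + lieD beta x Y F.
Proof.
move=> mF; apply/funext => s; rewrite lincomb_fctE /lieD -unsh_linear.
by apply: eq_unsh => A B _; rewrite lincomb_fctE (mlin_head _ mF).
Qed.

Lemma pull_linear j (a : k) (F G : seq V -> W) :
  pull beta j (a *: F + G) = a *: pull beta j F + pull beta j G.
Proof. by []. Qed.

End Linearity.

End ListCochains.

(** * The bracket of cochains on lists *)

Section ListBracket.
Variables (k : fieldType) (g : lmodType k) (A : homLie g).
Variables (V : lmodType k) (M : homLieRep A V).
Local Notation alpha := (hl_alpha A).
Local Notation beta := (rep_beta M).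
Local Notation pow j := (map (iter j beta)).
Local Notation pull := (pull beta).
Local Notation lieD := (lieD beta).
Local Notation brac := (hl_bracket A).
Local Notation act := (rep_act M).
Local Notation gcoch := (lcoch beta alpha).
Local Notation vcoch := (lcoch beta beta).
Implicit Types (P Q R F : seq V -> g) (n m p : nat).

(** The sum of {P(v_1, ..., v_n), beta^(n-1)(v_(n+1))} over signed (n,1)-unshuffles of the
    arguments. *)
Definition vfield n P : seq V -> V := wedge act P (pull n.-1 (@idform _ V)).

Definition wbr n m P Q : seq V -> g := wedge brac (pull m.-1 P) (pull n.-1 Q).

Definition brk n m P Q : seq V -> g :=
  lieD m (vfield m Q) P +
  (-1) ^+ (m * n) *: (wbr n m P Q - lieD n (vfield n P) Q).

Arguments vfield n%_N P _.
Arguments wbr (n m)%_N P Q _.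
Arguments brk (n m)%_N P Q _.

Lemma lcoch_vfield n P : gcoch n P -> vcoch n.+1 (vfield n P).
Proof.
move=> cP; rewrite -addn1; apply: lcoch_wedge cP _ => [u v|].
  by rewrite -rep_mult.
exact/lcoch_pull/lcoch_idform.
Qed.

Lemma lcoch_wbr n m P Q : gcoch n P -> gcoch m Q ->
  gcoch (n + m)%N (wbr n m P Q).
Proof.
move=> cP cQ; apply: lcoch_wedge (lcoch_pull _ cP) (lcoch_pull _ cQ) => u v.
by rewrite hl_mult.
Qed.

Lemma lcoch_ins n m P F : (0 < m)%N -> gcoch n P -> gcoch m F ->
  gcoch (n + m)%N (lieD n (vfield n P) F).
Proof. by move=> m0 cP cF; apply: lcoch_lieD (lcoch_vfield cP) cF. Qed.

Lemma lcoch_brk n m P Q : (0 < n)%N -> (0 < m)%N -> gcoch n P -> gcoch m Q ->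
  gcoch (n + m)%N (brk n m P Q).
Proof.
move=> n0 m0 cP cQ; rewrite /brk [lieD _ _ _ + _]addrC; apply: lcoch_linear.
  rewrite [wbr _ _ _ _ - _]addrC -scaleN1r.
  apply: lcoch_linear; last exact: lcoch_wbr.
  exact: lcoch_ins.
by rewrite addnC; apply: lcoch_ins.
Qed.

(** The sign of exchanging the blocks combines with the skew symmetry of the bracket of [g]. *)
Lemma wbr_skew n m P Q : gcoch n P -> gcoch m Q ->
  wbr m n Q P = - ((-1) ^+ (n * m) *: wbr n m P Q).
Proof.
move=> cP cQ; apply/funext => s.
rewrite opprfctE scalrfctE -scaleNr -unshZ [LHS]unsh_swap.
apply: eq_unsh => C D _; rewrite hl_skew.
have [eC|nC] := eqVneq (size C) n; last first.
  by rewrite (lcoch_supp (lcoch_pull _ cP)) // linear0l oppr0 !scaler0.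
have [eD|nD] := eqVneq (size D) m; last first.
  by rewrite (lcoch_supp (lcoch_pull _ cQ)) // linear0r oppr0 !scaler0.
by rewrite eC eD; parity; lin k.
Qed.

(** All three terms become sums over the blocks of [P], [Q] and [R] in this order; the hom-Jacobi
    identity then applies term by term. *)
Lemma wbr_jacobi n m p P Q R : (0 < n)%N -> (0 < m)%N -> (0 < p)%N ->
    gcoch n P -> gcoch m Q -> gcoch p R ->
  wbr n (m + p)%N P (wbr m p Q R) =
    wbr (n + m)%N p (wbr n m P Q) R +
    (-1) ^+ (n * m) *: wbr m (n + p)%N Q (wbr n p P R).
Proof.
case: n m p => [//|n] [//|m] [//|p] _ _ _ cP cQ cR.
rewrite /wbr !pull_wedge !pullD !addSn !addnS /=.
apply/funext => s; rewrite addrC lincomb_fctE.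
rewrite [X in _ = _ + X](_ : _ = unsh (fun B C => unsh (fun C D =>
   brac (brac (pull (p + m)%N P B) (pull (p + n)%N Q C))
     (pull (n + m).+1%N R D)) C) s); last first.
  rewrite -unsh_assoc; apply: eq_unsh => B C _.
  rewrite (@unsh_comp _ _ _ _ (brac^~ (pull (n + m).+1%N R C))) //.
  by move=> a u v; rewrite linearPl.
rewrite [X in _ = _ *: X + _](_ : _ = unsh (fun B C => unsh (fun C D =>
   brac (pull (n + p).+1%N Q B)
     (brac (pull (m + p)%N P C) (pull (m + n)%N R D))) C) s); last first.
  apply: eq_unsh => B C _.
  rewrite (@unsh_comp _ _ _ _ (brac (pull (n + p).+1%N Q B))) //.
  by move=> a u v; rewrite linearPr.
rewrite [LHS](_ : _ = unsh (fun B C => unsh (fun C D =>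
   brac (pull (m + p).+1%N P B)
     (brac (pull (n + p)%N Q C) (pull (n + m)%N R D))) C) s); last first.
  apply: eq_unsh => B C _.
  rewrite (@unsh_comp _ _ _ _ (brac (pull (m + p).+1%N P B))) //.
  by move=> a u v; rewrite linearPr.
(* The factor outside the inner bracket is pulled back once more than where it stands inside; this
   surplus is the [alpha] of the hom-Jacobi identity. *)
have pullS j F n' : gcoch n' F -> pull j.+1 F = alpha \o pull j F.
  by move=> cF; apply/funext => t; rewrite /= -(lcoch_equi cF) map_iterD.
rewrite (pullS _ _ _ cP) (pullS _ _ _ cQ) (pullS _ _ _ cR).
rewrite [X in _ = _ *: X + _]unsh_left_comm -unshZ -unshD.
apply: eq_unsh => B CD _; rewrite -unshZ -unshD; apply: eq_unsh => C D _ /=.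
rewrite [(p + m)%N]addnC [(p + n)%N]addnC [(m + n)%N]addnC.
have [eB|nB] := eqVneq (size B) n.+1; last first.
  rewrite (lcoch_supp (lcoch_pull _ cP)) // linear0 !(linear0l, linear0r).
  by rewrite !scaler0 addr0.
have [eC|nC] := eqVneq (size C) m.+1; last first.
  rewrite (lcoch_supp (lcoch_pull _ cQ)) // linear0 !(linear0l, linear0r).
  by rewrite !scaler0 addr0.
set x := pull _ P B; set y := pull _ Q C; set z := pull _ R D.
have := hl_jacobi A x y z; rewrite (hl_skew A z x) linearNr.
rewrite (hl_skew A (brac x y)) -eB -eC -addrA => /eqP.
rewrite addr_eq0 => /eqP->.
by parity; lin k.
Qed.
(** In the Leibniz rule for the wedge defining [vfield], the second term differentiates the identity
    form, which gives [X] back; it is moved to the other side. *)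
Lemma vfield_lieD n m P X : (0 < n)%N -> gcoch n P -> vcoch m.+1 X ->
  vfield (n + m) (lieD m X P) =
    lieD m X (vfield n P)
    - (-1) ^+ (m * n) *: wedge act (pull m P) (pull n.-1 X).
Proof.
case: n => // n _ cP cX.
rewrite /vfield (lieD_wedge _ _ (lcoch_supp cX) (lcoch_supp cP)); first last.
- by move=> s; apply/mlin_head0/mlin_pull; case: (lcoch_idform beta).
- by move=> s; apply/mlin_head0; case: cP.
rewrite -pull_lieD; last by case: cX.
by rewrite lieD_idform pullD addSn /= addnC addrK.
Qed.

(** The second axiom of a representation is applied on the blocks of [P], [Q] and the identity form.
    The twist of the identity form is one higher on the left, which is the [beta] in that axiom. *)
Lemma vfield_wbr n m P Q : (0 < n)%N -> (0 < m)%N -> gcoch n P -> gcoch m Q ->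
  vfield (n + m) (wbr n m P Q) =
    wedge act (pull m P) (pull n.-1 (vfield m Q))
    - (-1) ^+ (m * n) *: wedge act (pull n Q) (pull m.-1 (vfield n P)).
Proof.
case: n m => [//|n] [//|m] _ _ cP cQ.
rewrite /vfield /wbr !pull_wedge !pullD addSn addnS /=.
apply/funext => s; rewrite addrfctE opprfctE scalrfctE.
rewrite [LHS](_ : _ = unsh (fun B C => unsh (fun C D =>
   act (brac (pull m P B) (pull n Q C))
     (pull (n + m).+1%N (@idform _ V) D)) C) s);
  last first.
  rewrite -unsh_assoc; apply: eq_unsh => B C _.
  rewrite (@unsh_comp _ _ _ _ (act^~ (pull (n + m).+1%N (@idform _ V) C))) //.
  by move=> a u v; rewrite linearPl.
rewrite [X in _ = X - _](_ : _ = unsh (fun B C => unsh (fun C D =>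
   act (pull m.+1 P B) (act (pull n Q C) (pull (n + m) (@idform _ V) D))) C) s);
  last first.
  apply: eq_unsh => B C _.
  rewrite (@unsh_comp _ _ _ _ (act (pull m.+1 P B))) //.
  by move=> a u v; rewrite linearPr.
rewrite [X in _ = _ - _ *: X](_ : _ = unsh (fun B C => unsh (fun C D =>
   act (pull n.+1 Q B) (act (pull m P C) (pull (m + n) (@idform _ V) D))) C) s);
  last first.
  apply: eq_unsh => B C _.
  rewrite (@unsh_comp _ _ _ _ (act (pull n.+1 Q B))) //.
  by move=> a u v; rewrite linearPr.
rewrite [X in _ = _ - _ *: X]unsh_left_comm -scaleNr -unshZ -unshD.
apply: eq_unsh => B CD _; rewrite -unshZ -unshD; apply: eq_unsh => C D _ /=.
have pullS (W : lmodType k) (phi : W -> W) (F : seq V -> W) j t n' :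
    lcoch beta phi n' F -> pull j.+1 F t = phi (pull j F t).
  by move=> cF; rewrite /pull -(lcoch_equi cF) map_iterD.
rewrite (pullS _ _ _ _ _ _ cP) (pullS _ _ _ _ _ _ cQ).
rewrite (pullS _ _ _ _ _ _ (lcoch_idform beta)) rep_bracket [(m + n)%N]addnC.
have [eB|nB] := eqVneq (size B) n.+1; last first.
  rewrite (lcoch_supp (lcoch_pull _ cP)) // linear0 !(linear0l, linear0r).
  by rewrite !(scaler0, addr0, subr0).
have [eC|nC] := eqVneq (size C) m.+1; last first.
  rewrite (lcoch_supp (lcoch_pull _ cQ)) // linear0 !(linear0l, linear0r).
  by rewrite !(scaler0, addr0, subr0).
by rewrite eB eC; parity; lin k.
Qed.

Lemma linear_subZ (U W : lmodType k) (f : U -> W) x y a : linear f ->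
  f (x - a *: y) = f x - a *: f y.
Proof.
by move=> lf; rewrite [x - _]addrC -[- (a *: y)]scaleNr lf scaleNr addrC.
Qed.

Lemma linear_addZB (U W : lmodType k) (f : U -> W) x y z a : linear f ->
  f (x + a *: (y - z)) = f x + a *: (f y - f z).
Proof.
move=> lf; rewrite [x + _]addrC lf addrC -[z in LHS]scale1r linear_subZ //.
by rewrite scale1r.
Qed.

Lemma vfield_linear n : linear (vfield n).
Proof. by move=> a F G; apply: wedge_linearl. Qed.

Lemma wbr_linearl n m Q : linear (fun P => wbr n m P Q).
Proof. by move=> a F G; rewrite /wbr pull_linear wedge_linearl. Qed.

Lemma wbr_linearr n m P : linear (wbr n m P).
Proof. by move=> a F G; rewrite /wbr pull_linear wedge_linearr. Qed.

(** The two terms of [vfield_wbr] cancel the corrections that [vfield_lieD] gives for the two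
    insertions. *)
Lemma vfield_brk n m P Q : (0 < n)%N -> (0 < m)%N -> gcoch n P -> gcoch m Q ->
  vfield (n + m) (brk n m P Q) =
    lieD m (vfield m Q) (vfield n P)
    - (-1) ^+ (m * n) *: lieD n (vfield n P) (vfield m Q).
Proof.
move=> n0 m0 cP cQ; rewrite /brk (linear_addZB _ _ _ _ (vfield_linear _)).
rewrite vfield_wbr // vfield_lieD //; last exact: lcoch_vfield.
rewrite [in vfield _ (lieD n _ _)]addnC vfield_lieD //;
  last exact: lcoch_vfield.
by parity; lin k.
Qed.

Local Notation L n P := (lieD n (vfield n P)).

(** [vfield_brk] gives the vector field whose Lie derivative [lieD_comm] identifies with the graded
    commutator. *)
Lemma lieD_brk n m P Q F : (0 < n)%N -> (0 < m)%N -> gcoch n P -> gcoch m Q ->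
    mlin F -> asym F ->
  L (n + m)%N (brk n m P Q) F =
    L m Q (L n P F) - (-1) ^+ (m * n) *: L n P (L m Q F).
Proof.
move=> n0 m0 cP cQ mF aF; rewrite vfield_brk //.
rewrite (linear_subZ (f := fun X => lieD (n + m)%N X F)) //; last first.
  by move=> a X Y; apply: lieD_linearl.
have [[sP _ _ eP] [sQ _ _ eQ]] := (lcoch_vfield cP, lcoch_vfield cQ).
by rewrite (lieD_comm sQ sP eQ eP mF aF) [(m + n)%N]addnC.
Qed.

(** The extra pullback by [n] in the Leibniz rule is the growth of the twist in [wbr] when one
    degree increases by [n]. *)
Lemma lieD_wbr n m p P Q R : (0 < m)%N -> (0 < p)%N ->
    gcoch n P -> gcoch m Q -> gcoch p R ->
  L n P (wbr m p Q R) =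
    wbr (n + m) p (L n P Q) R + (-1) ^+ (n * m) *: wbr m (n + p) Q (L n P R).
Proof.
case: m p => [//|m] [//|p] _ _ cP cQ cR.
have cX := lcoch_vfield cP; rewrite /wbr.
rewrite (lieD_wedge _ _ (lcoch_supp cX) (lcoch_supp (lcoch_pull p cQ)));
  first last.
- by move=> s; apply/mlin_head0/mlin_pull; case: cR.
- by move=> s; apply/mlin_head0/mlin_pull; case: cQ.
by rewrite -!pull_lieD ?pullD ?addnS //; case: cX.
Qed.

Lemma lieD_linear n P : linear (fun F => L n P F).
Proof. by move=> a F G; apply: lieD_linearr. Qed.

Lemma brk_jacobi n m p P Q R : (0 < n)%N -> (0 < m)%N -> (0 < p)%N ->
    gcoch n P -> gcoch m Q -> gcoch p R ->
  brk n (m + p) P (brk m p Q R) =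
    brk (n + m) p (brk n m P Q) R +
    (-1) ^+ (n * m) *: brk m (n + p) Q (brk n p P R).
Proof.
move=> n0 m0 p0 cP cQ cR.
have brkE n' m' P' Q' : brk n' m' P' Q' = L m' Q' P' +
  (-1) ^+ (m' * n') *: (wbr n' m' P' Q' - L n' P' Q') by [].
(* Only the outer brackets are unfolded, so that [lieD_brk] still sees the inner ones as vector
   fields. *)
rewrite (brkE n (m + p)%N) (brkE (n + m)%N p) (brkE m (n + p)%N).
rewrite !lieD_brk //; try by [case: cP|case: cQ|case: cR].
rewrite ![brk _ _ _ _]/brk.
rewrite !(linear_addZB _ _ _ _ (lieD_linear _ _)).
rewrite !(linear_addZB _ _ _ _ (wbr_linearr _ _ _)).
rewrite !(linear_addZB _ _ _ _ (wbr_linearl _ _ _)).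
(* The wedge bracket of [Q] with the derivative of [P] along [R] occurs in both orders. *)
rewrite !lieD_wbr // wbr_jacobi // (wbr_skew cQ (lcoch_ins n0 cR cP)).
rewrite [(p + n)%N]addnC [(p + m)%N]addnC [(m + n)%N]addnC.
by parity; lin k.
Qed.

Lemma brk_skew n m P Q : gcoch n P -> gcoch m Q ->
  brk n m P Q = - ((-1) ^+ (n * m) *: brk m n Q P).
Proof.
by move=> cP cQ; rewrite /brk (wbr_skew cP cQ); parity; lin k.
Qed.

Lemma brk_linearr n m a P Q R : mlin P ->
  brk n m P (a *: Q + R) = a *: brk n m P Q + brk n m P R.
Proof.
move=> mP; rewrite /brk vfield_linear lieD_linearl // wbr_linearr lieD_linear.
by parity; lin k.
Qed.

Lemma brk_linearl n m a P Q R : mlin R ->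
  brk n m (a *: P + Q) R = a *: brk n m P R + brk n m Q R.
Proof.
move=> mR; rewrite /brk vfield_linear lieD_linearl // wbr_linearl lieD_linear.
by parity; lin k.
Qed.

End ListBracket.

(** * Sums over shuffles *)

Section LowerPerm.
Variable n : nat.
Implicit Types (i : 'I_n.+1) (s : 'S_n.+1).

(** Position [i] and its value are deleted from [s]. The default is never reached, as [s] is
    injective. *)
Definition lower_fun i s (j : 'I_n) := odflt j (unlift (s i) (s (lift i j))).

Lemma lift_lower_fun i s j : lift (s i) (lower_fun i s j) = s (lift i j).
Proof.
have : s i != s (lift i j) by rewrite (inj_eq perm_inj) neq_lift.
by rewrite /lower_fun => /unlift_some[j' -> ->].
Qed.

Lemma lower_inj i s : injective (lower_fun i s).
Proof.
move=> j1 j2 eqj; apply: (@lift_inj _ i); apply: (@perm_inj _ s).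
by rewrite -!lift_lower_fun eqj.
Qed.

Definition lower_perm i s : 'S_n := perm (@lower_inj i s).

Lemma lower_permK i s : lift_perm i (s i) (lower_perm i s) = s.
Proof.
apply/permP => j; case: (unliftP i j) => [j'|] ->; rewrite ?lift_perm_id //.
by rewrite lift_perm_lift permE lift_lower_fun.
Qed.

Lemma lift_permK_lower i j (s : 'S_n) : lower_perm i (lift_perm i j s) = s.
Proof.
apply/permP => h; rewrite permE; apply: (@lift_inj _ j).
by rewrite -{1}(lift_perm_id i j s) lift_lower_fun lift_perm_lift.
Qed.

End LowerPerm.

(** * Finite families as lists *)

Definition lst (T : Type) n (v : 'I_n -> T) : seq T :=
  [seq v i | i <- enum 'I_n].

Section Lst.
Variable T : Type.

Lemma size_lst n (v : 'I_n -> T) : size (lst v) = n.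
Proof. by rewrite size_map size_enum_ord. Qed.

Lemma nth_lst x0 n (v : 'I_n -> T) (i : 'I_n) : nth x0 (lst v) i = v i.
Proof. by rewrite (nth_map i) ?size_enum_ord // nth_ord_enum. Qed.

Lemma lst_nth x0 n (s : seq T) : size s = n ->
  lst (fun i : 'I_n => nth x0 s i) = s.
Proof.
move=> sn; apply: (@eq_from_nth _ x0); rewrite size_lst // => i lt_in.
exact: (nth_lst x0 _ (Ordinal lt_in)).
Qed.

Lemma lst_cast n m (e : n = m) (v : 'I_m -> T) :
  lst (fun i => v (cast_ord e i)) = lst v.
Proof.
by case: m / e v => v; apply: eq_map => i; rewrite cast_ord_id.
Qed.

Lemma lst_cons n (v : 'I_n.+1 -> T) :
  lst v = v ord0 :: lst (fun i => v (lift ord0 i)).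
Proof. by rewrite /lst enum_ordSl /= -map_comp. Qed.

Lemma lst_lift n (v : 'I_n.+1 -> T) (j : 'I_n.+1) :
  lst v = take j (lst (fun i => v (lift j i))) ++
    v j :: drop j (lst (fun i => v (lift j i))).
Proof.
have ltjn : (j <= n)%N by rewrite -ltnS.
apply: (@eq_from_nth _ (v j)) => [|i].
  rewrite size_cat /= size_take size_drop !size_lst; case: ifP; lia.
rewrite size_lst => lt_in; rewrite (nth_lst _ _ (Ordinal lt_in)).
rewrite nth_cat size_take size_lst.
have -> : (if (j < n)%N then j : nat else n) = j by case: ltnP => //; lia.
case: ltngtP => [ltij|ltji|eqij].
- have lt_in' : (i < n)%N by apply: leq_trans ltjn.
  rewrite nth_take // (nth_lst _ _ (Ordinal lt_in')); congr v; apply: val_inj.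
  by rewrite /= /bump leqNgt ltij.
- have lt_in' : (i.-1 < n)%N by lia.
  rewrite -[(i - j)%N]prednK ?subn_gt0 //= nth_drop.
  have -> : (j + (i - j).-1)%N = Ordinal lt_in' by rewrite /=; lia.
  rewrite nth_lst; congr v; apply: val_inj => /=; rewrite /bump; lia.
have -> : Ordinal lt_in = j by apply: val_inj.
by rewrite eqij subnn.
Qed.

End Lst.

Section ShuffleSums.
Variables (k : fieldType) (T : Type) (W : lmodType k).
Implicit Types (blk : nat -> nat) (G : seq T -> W).

(** Any block function is allowed, so that deleting position [j] is composition with [bump j]. *)
Definition block_shuffle N blk (tau : 'S_N) : bool :=
  [forall i : 'I_N, forall j : 'I_N,
     (i < j)%N && (blk i == blk j) ==> (tau i < tau j)%N].

Definition shsum N blk (v : 'I_N -> T) G : W :=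
  \sum_(tau : 'S_N | block_shuffle blk tau)
    (-1) ^+ tau *: G (lst (fun i => v (tau i))).

Definition block_first N blk (j : 'I_N) : bool :=
  [forall i : 'I_N, (i < j)%N ==> (blk i != blk j)].

(** The least value, placed first in its block, imposes no condition on the rest, which is merely
    renumbered. *)
Lemma block_shuffle_lift N blk (j : 'I_N.+1) (s : 'S_N) : block_first blk j ->
  block_shuffle blk (lift_perm j ord0 s) = block_shuffle (blk \o bump j) s.
Proof.
move=> /forallP fj; apply/idP/idP => /forallP sh.
  apply/forallP => h; apply/forallP => i; apply/implyP => /andP[lthi /= eqhi].
  have /forallP/(_ (lift j i))/implyP := sh (lift j h).
  rewrite !lift_perm_lift /= eqhi andbT /bump => lt2.
  suff : (lift ord0 (s h) < lift ord0 (s i))%N by rewrite /= /bump !add1n.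
  by apply: lt2; lia.
apply/forallP => h; apply/forallP => i; apply/implyP => /andP[lthi eqhi].
case: (unliftP j h) lthi eqhi => [h'|] ->; last first.
  case: (unliftP j i) => [i'|] ->; rewrite ?ltnn // => _ _.
  by rewrite lift_perm_id lift_perm_lift.
case: (unliftP j i) => [i'|] ->; last first.
  by move=> lth eqh; have := fj (lift j h'); rewrite lth eqh.
rewrite !lift_perm_lift /= => lth eqh.
have /forallP/(_ i')/implyP := sh h'; rewrite /= eqh andbT.
by move: lth; rewrite /bump /=; lia.
Qed.

(** Shuffles are sorted by the position [j] of the value 0; deleting it from the permutation changes
    the sign by (-1)^j. *)
Lemma shsumS N blk (v : 'I_N.+1 -> T) G :
  shsum blk v G = \sum_(j : 'I_N.+1 | block_first blk j)
    (-1) ^+ j *: shsum (blk \o bump j) (fun i => v (lift ord0 i))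
       (fun l => G (take j l ++ v ord0 :: drop j l)).
Proof.
rewrite /shsum (partition_big (fun tau : 'S_N.+1 => (tau^-1)%g ord0)
  (block_first blk)) /=; last first.
  (* An earlier position of the same block would carry a value below 0. *)
  move=> tau /forallP sh; apply/forallP => i; apply/implyP => lti.
  apply/negP => eqi; have /forallP/(_ ((tau^-1)%g ord0)) := sh i.
  by rewrite lti eqi permKV.
apply: eq_bigr => j fj; rewrite scaler_sumr.
rewrite (reindex_onto (lift_perm j ord0) (lower_perm j)) /=; last first.
  move=> tau /andP[_ /eqP <-]; rewrite -{2}(permKV tau ord0).
  by rewrite lower_permK.
apply: eq_big => [s|s _].
  rewrite block_shuffle_lift // lift_permK_lower eqxx andbT.
  by rewrite lift_permV lift_perm_id eqxx andbT.
rewrite scalerA.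
have -> : (-1) ^+ j * (-1) ^+ s = (-1) ^+ lift_perm j ord0 s :> k.
  by rewrite odd_lift_perm addbF signr_addb signr_odd.
congr (_ *: G _); rewrite (lst_lift _ j) lift_perm_id.
by rewrite (_ : (fun i => _) = (fun i => v (lift ord0 (s i)))) //;
  apply/funext => i; rewrite lift_perm_lift.
Qed.

(** An arithmetic form, accessible to [lia], of [reshape_index] on the positions in range. *)
Definition blk3 a b i : nat := ((a <= i) + (a + b <= i))%N.

Lemma eq_shsum N blk blk' (v : 'I_N -> T) G G' :
    (forall i, (i < N)%N -> blk i = blk' i) ->
    (forall l, size l = N -> G l = G' l) ->
  shsum blk v G = shsum blk' v G'.
Proof.
move=> eqb eqG; apply: eq_big => tau => [|_].
  apply: eq_forallb => i; apply: eq_forallb => j.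
  by rewrite !eqb.
by rewrite eqG // size_lst.
Qed.

Lemma block_first3 N a b c (j : 'I_N) : (a + b + c)%N = N ->
  block_first (blk3 a b) j =
  [|| (j == 0 :> nat) && (0 < a), (j == a :> nat) && (0 < b)
    | (j == a + b :> nat) && (0 < c)]%N.
Proof.
move=> abc; have ltj := ltn_ord j; apply/forallP/idP => [fj|fj i].
  case: (posnP j) => [j0|j_gt0]; first by rewrite /blk3 j0; lia.
  have ltj' : (j.-1 < N)%N by lia.
  by have := fj (Ordinal ltj'); rewrite /= /blk3; lia.
by apply/implyP; rewrite /blk3; lia.
Qed.

(** Starting positions coincide when a block is empty; the positivity tests prevent double
    counting. *)
Lemma sum_block_first N a b c (f : nat -> W) : (a + b + c)%N = N ->
  \sum_(j : 'I_N | block_first (blk3 a b) j) f j =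
    (if (0 < a)%N then f 0%N else 0) + (if (0 < b)%N then f a else 0) +
    (if (0 < c)%N then f (a + b)%N else 0).
Proof.
move=> abc; have sum1 h d : (0 < d -> h < N)%N ->
    (if (0 < d)%N then f h else 0) =
    \sum_(j < N) (if (j == h :> nat) && (0 < d)%N then f j else 0).
  case: (posnP d) => [_ _|d0 lth].
    by rewrite big1 // => j _; rewrite andbF.
  rewrite (bigD1 (Ordinal (lth isT))) //= eqxx big1 ?addr0 // => j.
  by rewrite -val_eqE => /negPf /= ->.
rewrite (sum1 0%N a) 1?(sum1 a b) 1?(sum1 (a + b)%N c); try lia.
rewrite -!big_split big_mkcond; apply: eq_bigr => j _ /=.
rewrite (block_first3 _ abc).
case: (boolP (_ && (0 < a)%N)) => [Ca|_].
  rewrite /= !ifF ?addr0 //; lia.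
case: (boolP (_ && (0 < b)%N)) => [Cb|_] /=.
  rewrite /= !ifF ?addr0 ?add0r //; lia.
by rewrite !add0r.
Qed.

Definition restr3 a b c (F : seq T -> seq T -> seq T -> W) A B C : W :=
  if [&& size A == a, size B == b & size C == c] then F A B C else 0.

Definition unsh3 (F : seq T -> seq T -> seq T -> W) s : W :=
  unsh (fun A BC => unsh (fun B C => F A B C) BC) s.

Lemma eq_unsh3 (F F' : seq T -> seq T -> seq T -> W) s :
    (forall A B C, (size A + size B + size C)%N = size s ->
      F A B C = F' A B C) ->
  unsh3 F s = unsh3 F' s.
Proof.
move=> eqF; apply: eq_unsh => A BC eqs; apply: eq_unsh => B C eqs'.
by apply: eqF; lia.
Qed.

Lemma unsh3D F F' s :
  unsh3 (fun A B C => F A B C + F' A B C) s = unsh3 F s + unsh3 F' s.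
Proof. by rewrite -unshD; apply: eq_unsh => A BC _; rewrite unshD. Qed.

Lemma unsh3Z a F s : unsh3 (fun A B C => a *: F A B C) s = a *: unsh3 F s.
Proof. by rewrite -unshZ; apply: eq_unsh => A BC _; rewrite unshZ. Qed.

Lemma unsh30 s : unsh3 (fun _ _ _ => 0) s = 0.
Proof.
by rewrite -[RHS](unsh0 W s); apply: eq_unsh => A BC _; rewrite unsh0.
Qed.

Lemma unsh3_cons (F : seq T -> seq T -> seq T -> W) x s :
  unsh3 F (x :: s) = unsh3 (fun A B C => F (x :: A) B C
    + (-1) ^+ size A *: F A (x :: B) C
    + (-1) ^+ (size A + size B) *: F A B (x :: C)) s.
Proof.
rewrite /unsh3 /=; apply: eq_unsh => A BC _; rewrite -unshZ -unshD.
by apply: eq_unsh => B C _; rewrite exprD scalerDr scalerA addrA.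
Qed.

(** Induction on [N]: the first vector opens one of the three blocks, at position 0, [a] or [a + b].
    These cases are the three terms of [unsh3_cons], with the same signs. *)
Lemma shsum_unsh3 N a b c (v : 'I_N -> T) F : (a + b + c)%N = N ->
  shsum (blk3 a b) v
    (fun l => F (take a l) (take b (drop a l)) (drop (a + b) l))
  = unsh3 (restr3 a b c F) (lst v).
Proof.
elim: N a b c v F => [|N IHN] a b c v F abc.
  move: abc; case: a b c => [|//] [|//] [|//] _.
  rewrite /shsum (big_pred1 1%g) => [|tau]; last first.
    rewrite [RHS](_ : _ = true); last by apply/eqP/permP => -[].
    by apply/forallP => -[].
  by rewrite odd_perm1 scale1r /lst !(size0nil (size_enum_ord 0)).
rewrite shsumS lst_cons; set v' := (fun i => v (lift ord0 i)).
pose f j := (-1) ^+ j *: shsum (blk3 a b \o bump j) v' (fun l =>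
  let l' := take j l ++ v ord0 :: drop j l in
  F (take a l') (take b (drop a l')) (drop (a + b) l')) : W.
rewrite (sum_block_first f abc) unsh3_cons !unsh3D.
congr (_ + _ + _).
- case: (posnP a) => [a0|a_gt0].
    rewrite -[LHS](unsh30 (lst v')); apply: eq_unsh3 => A B C _.
    by rewrite /restr3 a0.
  rewrite /f scale1r; case: a a_gt0 abc {f} => [//|a] _ [abc].
  rewrite (eq_unsh3 (F' := restr3 a b c (fun A => F (v ord0 :: A)))) //.
  rewrite -IHN //; apply: eq_shsum => [i ltiN|l sl] /=.
    by rewrite /blk3 /bump; lia.
  by rewrite take0 drop0.
- case: (posnP b) => [b0|b_gt0].
    rewrite -[LHS](unsh30 (lst v')); apply: eq_unsh3 => A B C _.
    by rewrite /restr3 b0 andbF scaler0.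
  rewrite /f; case: b b_gt0 abc {f} => [//|b] _ abc.
  rewrite (eq_unsh3 (F' := fun A B C =>
    (-1) ^+ a *: restr3 a b c (fun A B => F A (v ord0 :: B)) A B C)).
    rewrite unsh3Z -IHN; last by lia.
    congr (_ *: _); apply: eq_shsum => [i ltiN|l sl] /=.
      by rewrite /blk3 /bump; lia.
    have st : size (take a l) = a by rewrite size_take; case: ltnP; lia.
    rewrite take_size_cat // drop_size_cat // drop_cat st ifN ?addnS;
      last by lia.
    by rewrite subSn ?leq_addr // addKn /= drop_drop addnC.
  move=> A B C _; rewrite /restr3 /= eqSS.
  by case: eqP => [-> //|]; rewrite ?scaler0.
case: (posnP c) => [c0|c_gt0].
  rewrite -[LHS](unsh30 (lst v')); apply: eq_unsh3 => A B C _.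
  by rewrite /restr3 c0 !andbF scaler0.
rewrite /f; case: c c_gt0 abc {f} => [//|c] _ abc.
rewrite (eq_unsh3 (F' := fun A B C =>
  (-1) ^+ (a + b) *: restr3 a b c (fun A B C => F A B (v ord0 :: C)) A B C)).
  rewrite unsh3Z -IHN; last by lia.
  congr (_ *: _); apply: eq_shsum => [i ltiN|l sl] /=.
    by rewrite /blk3 /bump; lia.
  have st : size (take (a + b) l) = (a + b)%N.
    by rewrite size_take; case: ltnP; lia.
  rewrite [drop (a + b) (_ ++ _)]drop_size_cat //; congr (F _ _ _).
    by rewrite takel_cat ?st ?leq_addr // take_takel ?leq_addr.
  rewrite drop_cat st; case: ltnP => [lta|leb].
    rewrite takel_cat; last by rewrite size_drop st; lia.
    by rewrite [(a + b)%N]addnC -take_drop take_takel.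
  have -> : b = 0%N by lia.
  by rewrite !take0.
move=> A B C _; rewrite /restr3 /= eqSS.
case: eqP => [->|]; rewrite ?scaler0 //.
by case: eqP => [->|]; rewrite ?scaler0.
Qed.

End ShuffleSums.

Lemma reshape_index2 n m i : (i < n + m)%N ->
  reshape_index [:: n; m] i = blk3 n m i.
Proof. rewrite /reshape_index /blk3 /=; do ?case: ifP; lia. Qed.

Lemma reshape_index3 a b c i : (i < a + b + c)%N ->
  reshape_index [:: a; b; c] i = blk3 a b i.
Proof.
by rewrite /reshape_index /blk3 /=; do ?case: ifP; lia.
Qed.

(** * Extending maps on families to functions of lists *)

Section Extension.
Variables (k : fieldType) (V W : lmodType k).
Implicit Types (F : seq V -> W).

Definition ext n (P : ('I_n -> V) -> W) : seq V -> W :=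
  fun s => if size s == n then P (fun i => s`_i) else 0.

Lemma ext_lst n (P : ('I_n -> V) -> W) v : ext P (lst v) = P v.
Proof.
rewrite /ext size_lst eqxx; congr P; apply/funext => i.
exact: nth_lst.
Qed.

Lemma ext_supp n (P : ('I_n -> V) -> W) : supp n (ext P).
Proof. by move=> s /negPf ns; rewrite /ext ns. Qed.

Lemma ext_lstK n F : supp n F -> ext (fun v : 'I_n -> V => F (lst v)) = F.
Proof.
move=> sF; apply/funext => s; rewrite /ext.
by case: eqP => [sn|/eqP/sF-> //]; rewrite (lst_nth 0 sn).
Qed.

Lemma ext_inj n (P Q : ('I_n -> V) -> W) : ext P = ext Q -> P = Q.
Proof. by move=> eqPQ; apply/funext => v; rewrite -!ext_lst eqPQ. Qed.

Lemma nth_update n s1 s2 (z : V) (i : 'I_n) : size s1 = i ->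
  (fun j : 'I_n => (s1 ++ z :: s2)`_j) =
  [eta (fun j : 'I_n => (s1 ++ 0 :: s2)`_j) with i |-> z].
Proof.
move=> s1i; apply/funext => j /=; case: eqVneq => [->|].
  by rewrite nth_cat s1i ltnn subnn.
rewrite -val_eqE /= !nth_cat s1i; case: ltngtP => // ltij _.
by rewrite -[(j - i)%N]prednK // subn_gt0.
Qed.

Lemma ext_mlin n (P : ('I_n -> V) -> W) : multilinear P -> mlin (ext P).
Proof.
move=> mP s1 a x y s2; rewrite /ext !size_cat /=.
case: eqP => [sn|_]; last by rewrite scaler0 addr0.
have lt1n : (size s1 < n)%N by rewrite -sn addnS ltnS leq_addr.
have E z := @nth_update _ s1 s2 z (Ordinal lt1n) erefl.
by rewrite (E x) (E y) (E (a *: x + y)) mP.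
Qed.

(** Polarization: expanding the value at [x + y] in both slots leaves two mixed terms with sum
    zero. *)
Lemma ext_asym n (P : ('I_n -> V) -> W) : multilinear P -> alternating P ->
  asym (ext P).
Proof.
move=> mP aP s1 x y s2; have mE := ext_mlin mP.
have E0 z : ext P (s1 ++ z :: z :: s2) = 0.
  rewrite /ext !size_cat /=; case: eqP => // sn.
  have lt1n : (size s1 < n)%N by lia.
  have lt2n : ((size s1).+1 < n)%N by lia.
  apply: (aP _ (Ordinal lt1n) (Ordinal lt2n)) => /=.
    by rewrite -val_eqE /= ltn_eqF.
  by rewrite !nth_cat ltnn ltnNge leqnSn /= subnn subSnn.
have E2 u : ext P (s1 ++ u :: 1 *: x + y :: s2) =
    1 *: ext P (s1 ++ u :: x :: s2) + ext P (s1 ++ u :: y :: s2).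
  by rewrite -(cat_rcons u) mE 2!cat_rcons.
have := E0 (1 *: x + y); rewrite mE !E2 !E0.
by rewrite !scale1r add0r addr0 => /eqP; rewrite addr_eq0 => /eqP.
Qed.

Lemma lst_update n (v : 'I_n -> V) (i : 'I_n) z :
  lst [eta v with i |-> z] = take i (lst v) ++ z :: drop i.+1 (lst v).
Proof.
have sz : size (take i (lst v)) = i by rewrite size_takel // size_lst ltnW.
apply: (@eq_from_nth _ 0) => [|j]; rewrite size_lst.
  by rewrite size_cat /= sz size_drop size_lst; have := ltn_ord i; lia.
move=> lt_jn; rewrite (nth_lst _ _ (Ordinal lt_jn)) /= -val_eqE /=.
rewrite nth_cat sz; case: ltngtP => [ltji|ltij|->].
- by rewrite nth_take // (nth_lst _ _ (Ordinal lt_jn)).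
- rewrite -[(j - i)%N]prednK ?subn_gt0 //= nth_drop.
  have -> : (i.+1 + (j - i).-1)%N = Ordinal lt_jn by rewrite /=; lia.
  by rewrite nth_lst.
- by rewrite subnn.
Qed.

Lemma mlin_multilinear n F : mlin F ->
  multilinear (fun v : 'I_n -> V => F (lst v)).
Proof. by move=> mF v i a x y; rewrite !lst_update mF. Qed.

Lemma asym_alternating n F : 2%:R != 0 :> k -> asym F ->
  alternating (fun v : 'I_n -> V => F (lst v)).
Proof.
move=> k2 aF v i j; wlog ltij : i j / (i < j)%N => [IH|] ij vij.
  have [ltij|ltji|/val_inj eqij] := ltngtP i j; first exact: (IH i j).
    by apply: (IH j i) => //; rewrite eq_sym.
  by rewrite eqij eqxx in ij.
have szi : (i < size (lst v))%N by rewrite size_lst.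
have szj : (j < size (lst v))%N by rewrite size_lst.
rewrite -(cat_take_drop i (lst v)) (drop_nth 0 szi) nth_lst.
rewrite -(cat_take_drop (j - i.+1) (drop i.+1 _)) drop_drop subnK //.
by rewrite (drop_nth 0 szj) nth_lst -vij asym_repeat.
Qed.

End Extension.

(** * Comparison of the shuffle formulas with the bracket on lists *)

Section Bridge.
Variables (k : fieldType) (g : lmodType k) (A : homLie g).
Variables (V : lmodType k) (M : homLieRep A V).
Local Notation alpha := (hl_alpha A).
Local Notation beta := (rep_beta M).
Local Notation pow j := (map (iter j beta)).
Local Notation gcoch := (lcoch beta alpha).

Lemma lst_comp n (f : V -> V) (v : 'I_n -> V) :
  lst (fun i => f (v i)) = map f (lst v).
Proof. by rewrite /lst -map_comp. Qed.

Lemma lcoch_ext n (P : cochain beta alpha n) : gcoch n (ext P).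
Proof.
have /asboolP[mP aP eP] := cochainP P.
split; [exact: ext_supp|exact: ext_mlin|exact: ext_asym|move=> s].
rewrite /ext size_map; case: eqP => [sn|_]; last by rewrite linear0.
rewrite eP; congr (cochain_fun P _); apply/funext => i.
by rewrite (nth_map 0) ?sn.
Qed.

Lemma lcoch_cochain n (F : seq V -> g) : 2%:R != 0 :> k -> gcoch n F ->
  (fun v : 'I_n -> V => F (lst v)) \in cochain_pred beta alpha (n := n).
Proof.
move=> k2 [sF mF aF eF]; apply/asboolP; split.
- exact: mlin_multilinear.
- exact: asym_alternating.
- by move=> v; rewrite -eF lst_comp.
Qed.

Lemma iter_ext n j (P : cochain beta alpha n) s :
  iter j alpha (ext P s) = pull beta j (ext P) s.
Proof. by rewrite /pull (equi_iter _ _ (lcoch_equi (lcoch_ext P))). Qed.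

(** The three blocks hold the arguments of [Q], the vector acted upon, and the other arguments of
    [P]. Coassociativity merges the unshuffles of [lieD] and [vfield] into [unsh3], which
    [shsum_unsh3] compares with the shuffles. *)
Lemma insertion_sumE n m (P : cochain beta alpha n) (Q : cochain beta alpha m)
    (v : 'I_(m + n) -> V) : (0 < n)%N ->
  insertion_sum M P Q v = lieD beta m (vfield M m (ext Q)) (ext P) (lst v).
Proof.
case: n P v => // n P v _.
have cP := lcoch_ext P; have cQ := lcoch_ext Q.
pose F X Y Z :=
  ext P (rep_act M (ext Q X) (iter m.-1 beta (idform Y)) :: pow m Z).
transitivity (unsh3 (restr3 m 1 n F) (lst v)); last first.
  rewrite /lieD /vfield.
  (* Restricting the block sizes changes nothing: [F] vanishes elsewhere by the supports of [Q],
     [idform] and [P]. *)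
  rewrite (eq_unsh3 (F' := F)) => [|X Y Z _]; last first.
    rewrite /restr3; case: eqP => [_|/eqP nX] /=; last first.
      by rewrite /F (lcoch_supp cQ) // linear0l mlin_head0 //; case: cP.
    case: eqP => [_|/eqP nY] /=; last first.
      rewrite /F (lcoch_supp (lcoch_idform beta) nY) /=.
      rewrite (_ : iter _ _ _ = 0) ?linear0r ?mlin_head0 //; first by case: cP.
      by elim: m.-1 => //= j ->; rewrite linear0.
    case: eqP => [_|/eqP nZ] //=.
    by rewrite /F (lcoch_supp cP) //= size_map eqSS.
  rewrite /unsh3 -unsh_assoc; apply: eq_unsh => XY Z _.
  rewrite /wedge (unsh_comp _ _ (mlin_head _ (lcoch_mlin cP))).
  apply: eq_unsh => X Y _; rewrite /F /pull.
  by rewrite (equi_iter _ _ (lcoch_equi (lcoch_idform beta))).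
rewrite -shsum_unsh3; last by rewrite addn1 addnS.
rewrite -(@eq_shsum _ _ _ _ (reshape_index [:: m; 1%N; n]) _ _
  (fun l => F (take m l) (take 1 (drop m l)) (drop (m + 1) l))) //; last first.
  by move=> i lti; rewrite reshape_index3 // addn1 addSnnS.
apply: eq_bigr => tau _; congr (_ *: _); set l := lst _.
have nl (i : 'I_(m + n.+1)) : l`_i = v (tau i) by rewrite nth_lst.
rewrite -[LHS]ext_lst lst_cons /= -ext_lst.
have sl : size l = (m + n.+1)%N by rewrite size_lst.
congr (ext P (rep_act M (ext Q _) (iter _ _ _) :: _)).
- apply: (@eq_from_nth _ 0) => [|i]; rewrite size_lst.
    by rewrite size_takel // sl leq_addr.
  move=> ltim; rewrite (nth_lst _ _ (Ordinal ltim)) nth_take //.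
  by rewrite -nl.
- rewrite (drop_nth 0) ?sl ?addnS ?ltnS ?leq_addr //= take0 /=.
  by rewrite -nl /= addn0.
apply: (@eq_from_nth _ 0) => [|i]; rewrite size_lst.
  by rewrite size_map size_drop sl; lia.
move=> ltin; rewrite (nth_lst _ _ (Ordinal ltin)) (nth_map 0); last first.
  by rewrite size_drop sl; lia.
by rewrite -nl nth_drop /= /bump; congr (iter m _ (nth 0 l _)); lia.
Qed.

(** Shuffles of two blocks are treated as shuffles of three blocks, the last one empty. *)
Lemma bracket_sumE n m (P : cochain beta alpha n) (Q : cochain beta alpha m)
    (v : 'I_(n + m) -> V) :
  \sum_(tau : 'S_(n + m) | shuffle [:: n; m] tau)
       (-1) ^+ tau *:
         hl_bracket A
           (iter m.-1 alpha (P (fun i => v (tau (lshift m i)))))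
           (iter n.-1 alpha (Q (fun j => v (tau (rshift n j)))))
  = wbr M n m (ext P) (ext Q) (lst v).
Proof.
have cP := lcoch_ext P; have cQ := lcoch_ext Q.
pose F X Y (Z : seq V) :=
  hl_bracket A (pull beta m.-1 (ext P) X) (pull beta n.-1 (ext Q) Y).
transitivity (unsh3 (restr3 n m 0 F) (lst v)); last first.
  apply: eq_unsh => X YZ _.
  rewrite -[RHS](unsh_nilr (fun Y => F X Y [::])); apply: eq_unsh => Y [|z Z] _.
    rewrite /restr3 /F andbT; case: eqP => [_|/eqP nX] /=; last first.
      by rewrite (lcoch_supp (lcoch_pull _ cP)) // linear0l.
    case: eqP => [_|/eqP nY] //=.
    by rewrite (lcoch_supp (lcoch_pull _ cQ)) // linear0r.
  by rewrite /restr3 !andbF.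
rewrite -shsum_unsh3 ?addn0 //.
rewrite -(@eq_shsum _ _ _ _ (reshape_index [:: n; m]) _ _
  (fun l => F (take n l) (take m (drop n l)) (drop (n + m) l))) //; last first.
  by move=> i lti; rewrite reshape_index2.
apply: eq_bigr => tau _; congr (_ *: _); set l := lst _.
have nl (i : 'I_(n + m)) : l`_i = v (tau i) by rewrite nth_lst.
have sl : size l = (n + m)%N by rewrite size_lst.
rewrite /F -!iter_ext -[P _]ext_lst -[Q _]ext_lst.
congr (hl_bracket A (iter _ _ (ext P _)) (iter _ _ (ext Q _))).
  apply: (@eq_from_nth _ 0) => [|i]; rewrite size_lst.
    by rewrite size_takel // sl leq_addr.
  by move=> ltim; rewrite (nth_lst _ _ (Ordinal ltim)) nth_take // -nl.
apply: (@eq_from_nth _ 0) => [|i]; rewrite size_lst.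
  by rewrite size_takel // size_drop sl addKn.
move=> ltim; rewrite (nth_lst _ _ (Ordinal ltim)) nth_take // nth_drop.
by rewrite -nl.
Qed.

Lemma cochain_bracketE n m (P : cochain beta alpha n) (Q : cochain beta alpha m)
    (v : 'I_(n + m) -> V) : (0 < n)%N -> (0 < m)%N ->
  cochain_bracket M P Q v = brk M n m (ext P) (ext Q) (lst v).
Proof.
move=> n0 m0; rewrite /cochain_bracket bracket_sumE !insertion_sumE //.
by rewrite lst_cast.
Qed.

End Bridge.

(** * The graded Lie algebra *)

Section CochainBracket.
Variables (k : fieldType) (g : lmodType k) (A : homLie g).
Variables (V : lmodType k) (M : homLieRep A V).
Hypothesis k2 : 2%:R != 0 :> k.
Local Notation C := (cochain (rep_beta M) (hl_alpha A)).

(* Degree [0] is outside the graded Lie algebra: [insubd] may return the junk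
   value [0] there. *)
Definition cbr n m (P : C n) (Q : C m) : C (n + m)%N :=
  insubd (0 : C (n + m)%N) (fun v => brk M n m (ext P) (ext Q) (lst v)).

Lemma cbrE n m (P : C n) (Q : C m) v : (0 < n)%N -> (0 < m)%N ->
  cbr P Q v = brk M n m (ext P) (ext Q) (lst v).
Proof.
move=> n0 m0; rewrite -[cochain_fun _]/(val (cbr P Q)) val_insubd.
rewrite lcoch_cochain //.
by apply: lcoch_brk => //; apply: lcoch_ext.
Qed.

Lemma ext_cbr n m (P : C n) (Q : C m) : (0 < n)%N -> (0 < m)%N ->
  ext (cbr P Q) = brk M n m (ext P) (ext Q).
Proof.
move=> n0 m0; rewrite -[RHS](@ext_lstK _ _ _ (n + m)%N).
  by congr ext; apply/funext => v; rewrite cbrE.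
by case: (lcoch_brk n0 m0 (lcoch_ext P) (lcoch_ext Q)).
Qed.

Lemma ext_cochain_inj n (P Q : C n) : ext P = ext Q -> P = Q.
Proof. by move/ext_inj => eqPQ; apply: val_inj. Qed.

Lemma ext_cochain_linear n a (P Q : C n) :
  ext (a *: P + Q : C n) = a *: ext P + ext Q.
Proof.
apply/funext => s; rewrite lincomb_fctE /ext.
case: eqP => _; first exact: erefl.
by rewrite scaler0 addr0.
Qed.

Lemma ext_cochainZ n a (P : C n) : ext (a *: P : C n) = a *: ext P.
Proof.
apply/funext => s; rewrite scalrfctE /ext; case: eqP => // _.
by rewrite scaler0.
Qed.

Lemma ext_cochainN n (P : C n) : ext (- P : C n) = - ext P.
Proof. by rewrite -!scaleN1r ext_cochainZ. Qed.

Lemma ext_cochainD n (P Q : C n) : ext (P + Q : C n) = ext P + ext Q.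
Proof. by rewrite -[P in LHS]scale1r ext_cochain_linear scale1r. Qed.

(** Functions of lists do not carry the degree in their type, so [ext] removes the casts from the
    graded axioms. *)
Lemma ext_degree_cast n m (e : n = m) (P : C n) :
  ext (degree_cast (L := C) e P) = ext P.
Proof. by case: m / e. Qed.

Lemma cbr_graded_lie : graded_lie (L := C) cbr.
Proof.
split=> [n m P n0 m0 a Q R|n m Q n0 m0 a P R|n m P Q n0 m0
        |n m p P Q R n0 m0 p0];
  apply: ext_cochain_inj; rewrite ?(ext_cochain_linear, ext_cochainN).
- rewrite !ext_cbr // ext_cochain_linear brk_linearr //.
  by case: (lcoch_ext P).
- rewrite !ext_cbr // ext_cochain_linear brk_linearl //.
  by case: (lcoch_ext Q).
- rewrite ext_cochainZ ext_degree_cast !ext_cbr //.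
  exact: brk_skew (lcoch_ext P) (lcoch_ext Q).
rewrite ext_cochainD ext_cochainZ !ext_degree_cast.
rewrite !ext_cbr ?addn_gt0 ?n0 ?m0 //.
exact: brk_jacobi n0 m0 p0 (lcoch_ext P) (lcoch_ext Q) (lcoch_ext R).
Qed.

(** In degree one the sign is -1, so the two insertion sums add up; skew symmetry doubles the
    bracket term as well. *)
Lemma brk11E (P : seq V -> g) x y : lcoch (rep_beta M) (hl_alpha A) 1 P ->
  brk M 1 1 P P [:: x; y] = 2%:R *:
   (P [:: rep_act M (P [:: x]) y] - P [:: rep_act M (P [:: y]) x]
    - hl_bracket A (P [:: x]) (P [:: y])).
Proof.
move=> cP; have supp1 := lcoch_supp cP.
have P0 : P [::] = 0 by apply: supp1.
have P2 a b s : P [:: a, b & s] = 0 by apply: supp1.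
have P1 u v : P [:: u - v] = P [:: u] - P [:: v].
  rewrite -[v in LHS]scale1r.
  rewrite (linear_subZ _ _ _ (mlin_head [::] (lcoch_mlin cP))).
  by rewrite scale1r.
rewrite /brk !addrfctE scalrfctE opprfctE /lieD /vfield /wbr /wedge /pull /=.
rewrite !(P0, P2, linear0l, linear0r, expr0, expr1, scaler0, addr0, add0r).
rewrite !(scale1r, scaleN1r, oppr0).
rewrite ![- rep_act _ _ _ + _]addrC !P1 (hl_skew A (P [:: y])).
set a := P [:: rep_act M (P [:: x]) y].
set b := P [:: rep_act M (P [:: y]) x].
by set c := hl_bracket A _ _; lin k.
Qed.

(** By [brk11E] the bracket of [T] with itself is twice the defect of the identity for an
    O-operator, and 2 can be cancelled. *)
Lemma maurer_cartan_cochain1 (T : {linear V -> g})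
    (hT : forall v, T (rep_beta M v) = hl_alpha A (T v)) :
  O_operator M T <-> maurer_cartan (L := C) cbr (cochain1 hT).
Proof.
pose E := ext (cochain1 hT).
have ET x : E [:: x] = T x by [].
have brT x y : brk M 1 1 E E [:: x; y] = 2%:R *:
   (T (rep_act M (T x) y - rep_act M (T y) x) - hl_bracket A (T x) (T y)).
  by rewrite (brk11E _ _ (lcoch_ext (cochain1 hT))) -/E !ET (linearB T).
split=> [[_ OT]|MC].
  apply: val_inj; apply/funext => v /=; rewrite cbrE // !lst_cons /=.
  rewrite [lst _](_ : _ = [::]); last by apply: size0nil; rewrite size_lst.
  by rewrite brT OT subrr scaler0.
split=> // x y; apply/eqP; rewrite eq_sym -subr_eq0.
have := brT x y; rewrite -ext_cbr // MC /ext /= => /esym/eqP.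
by rewrite scaler_eq0 (negPf k2).
Qed.

End CochainBracket.

Theorem theorem3p9 (k : fieldType) (hk : [pchar k] =i pred0)
    (g : lmodType k) (A : homLie g) (V : lmodType k) (M : homLieRep A V) :
  let C (n : nat) : lmodType k := cochain (rep_beta M) (hl_alpha A) n in
  exists br : forall n m : nat, C n -> C m -> C (n + m)%N,
    [/\ forall (n m : nat) (P : C n) (Q : C m), (0 < n)%N -> (0 < m)%N ->
          forall v : 'I_(n + m) -> V, br n m P Q v = cochain_bracket M P Q v,
        graded_lie br
      & forall (T : {linear V -> g})
               (hT : forall v, T (rep_beta M v) = hl_alpha A (T v)),
          O_operator M T <-> maurer_cartan br (cochain1 hT)].
Proof.
(* Invertibility of 2 makes antisymmetric maps alternating and allows the factor in the
   Maurer-Cartan equation to be cancelled. *)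
have k2 : 2%:R != 0 :> k.
  by apply/negP => k2; have := hk 2%N; rewrite !inE /= k2.
exists (@cbr k g A V M); split.
- by move=> n m P Q n0 m0 v; rewrite cbrE // cochain_bracketE.
- exact: cbr_graded_lie.
- exact: maurer_cartan_cochain1.
Qed.
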